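(* Let $A\in\mathbb{H}^{m\times n}$, let $I=(i_1,\dots,i_k)$ be a list of $k$ distinct row indices and $J=(j_1,\dots,j_k)$ a list of $k$ distinct column indices, and let $B=A[I,J]\in\mathbb{H}^{k\times k}$ be nonsingular. Put $C=A[:,J]B^{-1}\in\mathbb{H}^{m\times k}$ and $C'=B^{-1}A[I,:]\in\mathbb{H}^{k\times n}$. Consider a two-sided MaxVol procedure that accepts a row swap (replacing the $q$th selected row index $i_q$ by $p\notin I$) only if $|C_{pq}|>1$, and accepts a column swap (replacing the $q$th selected column index $j_q$ by $r\notin J$) only if $|C'_{qr}|>1$. Then every accepted swap strictly increases the volume of the core: if $B_{\rm new}$ denotes the core after the swap, then $\operatorname{vol}(B_{\rm new})>\operatorname{vol}(B)$. More precisely, $$\operatorname{vol}(B_{\rm new})=\begin{cases}|C_{pq}|\,\operatorname{vol}(B), & \text{for an accepted row swap},\\ |C'_{qr}|\,\operatorname{vol}(B), & \text{for an accepted column swap}.\end{cases}$$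
   Context: $\mathbb{H}$ is the skew field of real quaternions $q=q_0+q_1i+q_2j+q_3k$, with conjugate $q^*=q_0-q_1i-q_2j-q_3k$ and modulus $|q|=(q_0^2+q_1^2+q_2^2+q_3^2)^{1/2}$. Every $M\in\mathbb{H}^{m\times n}$ can be written uniquely as $M=X+Yj$ with $X,Y\in\mathbb{C}^{m\times n}$; the complex embedding is $\Phi(M)=\begin{bmatrix}X&Y\\-\overline Y&\overline X\end{bmatrix}\in\mathbb{C}^{2m\times 2n}$ (injective and multiplicative). For square $M\in\mathbb{H}^{k\times k}$, the Study determinant is $\mathrm{Sdet}(M)=|\det\Phi(M)|$ and the volume is $\operatorname{vol}(M)=\sqrt{\mathrm{Sdet}(M)}$ (equivalently, the product of the quaternion singular values of $M$). For index lists $I,J$, $A[I,J]$ is the submatrix with rows $I$ and columns $J$ in the listed order; $A[:,J]$ and $A[I,:]$ are the submatrices of the columns in $J$ and of the rows in $I$. Nonsingular means having a two-sided inverse over $\mathbb{H}$. A row swap replaces the $q$th row of $B$ by $A[p,J]$; a column swap replaces the $q$th column of $B$ by $A[I,r]$. *)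

(* Defs.v *)
From HB Require Import structures.
From mathcomp Require Import all_boot all_order all_algebra.
From mathcomp Require Import complex reals ring.

Set Implicit Arguments.
Unset Strict Implicit.
Unset Printing Implicit Defensive.

Import Order.TTheory GRing.Theory Num.Theory.

Local Open Scope ring_scope.
Local Open Scope complex_scope.

(* [Quat q0 q1 q2 q3] is q0 + q1 i + q2 j + q3 k. *)
Record quaternion (R : Type) : Type :=
  Quat { quat0 : R; quat1 : R; quat2 : R; quat3 : R }.

Section QuaternionEqChoice.
Variable R : Type.

Definition quat_encode (q : quaternion R) : R * R * R * R :=
  (quat0 q, quat1 q, quat2 q, quat3 q).

Definition quat_decode (t : R * R * R * R) : quaternion R :=
  let: (a, b, c, d) := t in Quat a b c d.

Lemma quat_encodeK : cancel quat_encode quat_decode.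
Proof. by case. Qed.
End QuaternionEqChoice.

HB.instance Definition _ (R : eqType) :=
  Equality.copy (quaternion R) (can_type (@quat_encodeK R)).
HB.instance Definition _ (R : choiceType) :=
  Choice.copy (quaternion R) (can_type (@quat_encodeK R)).

Section QuaternionRing.
Variable R : comNzRingType.
Implicit Types p q r : quaternion R.

Definition quat_zero : quaternion R := Quat 0 0 0 0.

Definition quat_one : quaternion R := Quat 1 0 0 0.

Definition quat_add p q : quaternion R :=
  Quat (quat0 p + quat0 q) (quat1 p + quat1 q)
       (quat2 p + quat2 q) (quat3 p + quat3 q).

Definition quat_opp q : quaternion R :=
  Quat (- quat0 q) (- quat1 q) (- quat2 q) (- quat3 q).

Definition quat_mul p q : quaternion R :=
  let: Quat a0 a1 a2 a3 := p in
  let: Quat b0 b1 b2 b3 := q in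
  Quat (a0 * b0 - a1 * b1 - a2 * b2 - a3 * b3)
       (a0 * b1 + a1 * b0 + a2 * b3 - a3 * b2)
       (a0 * b2 - a1 * b3 + a2 * b0 + a3 * b1)
       (a0 * b3 + a1 * b2 - a2 * b1 + a3 * b0).

Lemma quat_addA : associative quat_add.
Proof. by case=> ? ? ? ? [? ? ? ?] [? ? ? ?]; rewrite /quat_add /= !addrA. Qed.

Lemma quat_addC : commutative quat_add.
Proof. by case=> ? ? ? ? [? ? ? ?]; congr Quat; rewrite addrC. Qed.

Lemma quat_add0 : left_id quat_zero quat_add.
Proof. by case=> ? ? ? ?; congr Quat; rewrite add0r. Qed.

Lemma quat_addN : left_inverse quat_zero quat_opp quat_add.
Proof. by case=> ? ? ? ?; congr Quat; rewrite addNr. Qed.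

HB.instance Definition _ := GRing.isZmodule.Build (quaternion R)
  quat_addA quat_addC quat_add0 quat_addN.

Lemma quat_mulA : associative quat_mul.
Proof. by case=> ? ? ? ? [? ? ? ?] [? ? ? ?]; congr Quat; ring. Qed.

Lemma quat_mul1l : left_id quat_one quat_mul.
Proof. by case=> ? ? ? ?; congr Quat; ring. Qed.

Lemma quat_mul1r : right_id quat_one quat_mul.
Proof. by case=> ? ? ? ?; congr Quat; ring. Qed.

Lemma quat_mulDl : left_distributive quat_mul quat_add.
Proof. by case=> ? ? ? ? [? ? ? ?] [? ? ? ?]; congr Quat => /=; ring. Qed.

Lemma quat_mulDr : right_distributive quat_mul quat_add.
Proof. by case=> ? ? ? ? [? ? ? ?] [? ? ? ?]; congr Quat => /=; ring. Qed.

Lemma quat_one_neq0 : quat_one != 0.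
Proof. by apply/eqP => -[] /eqP; rewrite oner_eq0. Qed.

HB.instance Definition _ := GRing.Zmodule_isNzRing.Build (quaternion R)
  quat_mulA quat_mul1l quat_mul1r quat_mulDl quat_mulDr quat_one_neq0.

Definition quat_i : quaternion R := Quat 0 1 0 0.
Definition quat_j : quaternion R := Quat 0 0 1 0.
Definition quat_k : quaternion R := Quat 0 0 0 1.

Lemma quat_relations :
  [/\ quat_i * quat_i = -1, quat_j * quat_j = -1,
      quat_k * quat_k = -1 & quat_i * quat_j * quat_k = -1].
Proof. by split; congr Quat => /=; ring. Qed.

End QuaternionRing.

Section QuaternionMatrix.
Variable R : rcfType.

Definition quat_abs (q : quaternion R) : R :=
  Num.sqrt (quat0 q ^+ 2 + quat1 q ^+ 2 + quat2 q ^+ 2 + quat3 q ^+ 2).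

Definition quat_of_complex (z : R[i]) : quaternion R :=
  Quat (complex.Re z) (complex.Im z) 0 0.

(* q = quat_X q + quat_Y q j, since (q2 + q3 i) j = q2 j + q3 k. *)
Definition quat_X (q : quaternion R) : R[i] := quat0 q +i* quat1 q.
Definition quat_Y (q : quaternion R) : R[i] := quat2 q +i* quat3 q.

Lemma quat_XYj (q : quaternion R) :
  q = quat_of_complex (quat_X q) + quat_of_complex (quat_Y q) * quat_j R.
Proof. by case: q => ? ? ? ?; congr Quat => /=; ring. Qed.

Lemma quat_XYj_unique (x y : R[i]) (q : quaternion R) :
  q = quat_of_complex x + quat_of_complex y * quat_j R ->
  x = quat_X q /\ y = quat_Y q.
Proof.
by case: x y => ? ? [? ?] ->; split; congr Complex => /=; ring.
Qed.

Definition complex_embedding (m n : nat) (M : 'M[quaternion R]_(m, n)) :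
    'M[R[i]]_(m + m, n + n) :=
  let X := map_mx quat_X M in
  let Y := map_mx quat_Y M in
  block_mx X Y (- map_mx conjc Y) (map_mx conjc X).

(* [normc] is the R-valued modulus of R[i]; the norm `|_| is R[i]-valued. *)
Definition Sdet (k : nat) (M : 'M[quaternion R]_k) : R :=
  ComplexField.Normc.normc (\det (complex_embedding M)).

Definition vol (k : nat) (M : 'M[quaternion R]_k) : R := Num.sqrt (Sdet M).

(* The library's [unitmx] and [invmx] require commutative coefficients. *)
Definition is_inverse_mx (k : nat) (B N : 'M[quaternion R]_k) : Prop :=
  B *m N = 1%:M /\ N *m B = 1%:M.

End QuaternionMatrix.

(* [RowSwap q p] replaces the q-th selected row index by p, and [ColSwap q r]
   replaces the q-th selected column index by r. *)
Inductive swap (m n k : nat) : Type :=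
  | RowSwap of 'I_k & 'I_m
  | ColSwap of 'I_k & 'I_n.
Arguments RowSwap {m n k} q p.
Arguments ColSwap {m n k} q r.

Section MaxVol.
Variables (R : rcfType) (m n k : nat) (A : 'M[quaternion R]_(m, n)).

(* Index lists of length k are functions on 'I_k, [injective] when the indices
   are distinct; [mxsub I J A] is then the core A[I, J]. *)
Definition core_after (I : 'I_k -> 'I_m) (J : 'I_k -> 'I_n)
    (s : swap m n k) : 'M[quaternion R]_k :=
  match s with
  | RowSwap q p => mxsub [eta I with q |-> p] J A
  | ColSwap q r => mxsub I [eta J with q |-> r] A
  end.

(* N stands for the inverse of the core, so
   these are the moduli of the entries of C = A[:, J] N and C' = N A[I, :]. *)
Definition swap_factor (I : 'I_k -> 'I_m) (J : 'I_k -> 'I_n)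
    (N : 'M[quaternion R]_k) (s : swap m n k) : R :=
  match s with
  | RowSwap q p => quat_abs ((colsub J A *m N) p q)
  | ColSwap q r => quat_abs ((N *m rowsub I A) q r)
  end.

Definition swap_outside (I : 'I_k -> 'I_m) (J : 'I_k -> 'I_n)
    (s : swap m n k) : Prop :=
  match s with
  | RowSwap q p => p \notin codom I
  | ColSwap q r => r \notin codom J
  end.

(* A procedure is represented by the swaps it accepts at each pair of index
   lists; only necessary conditions for acceptance are imposed. *)
Definition two_sided_maxvol
    (accept : ('I_k -> 'I_m) -> ('I_k -> 'I_n) -> swap m n k -> Prop) : Prop :=
  forall (I : 'I_k -> 'I_m) (J : 'I_k -> 'I_n) (N : 'M[quaternion R]_k)
         (s : swap m n k),
    injective I -> injective J -> is_inverse_mx (mxsub I J A) N ->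
    accept I J s -> swap_outside I J s /\ 1 < swap_factor I J N s.

End MaxVol.

(* Main.v *)
(* Since A[:, J] = C B, a row swap multiplies the core on the left by
   1 + e_q (C_p - e_q^T), where C_p is the p-th row of C; symmetrically, a
   column swap multiplies it on the right.  The embedding is multiplicative, so
   det (1 + U V) = det (1 + V U) reduces the Study determinant of this rank-one
   perturbation of the identity to that of a quaternion. *)

Require Import Defs.
From mathcomp Require Import all_boot all_order all_algebra.
From mathcomp Require Import complex reals ring.

Import Order.TTheory GRing.Theory Num.Theory.

Local Open Scope ring_scope.

(** Both sides are the determinant of the block matrix with rows [1, -U] and [V, 1], which factors
    into block triangular matrices through either of its Schur complements. *)
Lemma det_1DmulmxC (F : comNzRingType) (m n : nat)
    (U : 'M[F]_(m, n)) (V : 'M[F]_(n, m)) :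
  \det (1%:M + U *m V) = \det (1%:M + V *m U).
Proof.
have eqL : block_mx 1%:M (- U) V 1%:M =
    block_mx 1%:M 0 V 1%:M *m block_mx 1%:M (- U) 0 (1%:M + V *m U).
  rewrite mulmx_block !mulmx1 !mul1mx !mul0mx !addr0 mulmxN.
  by rewrite addrCA addNr addr0.
have eqU : block_mx 1%:M (- U) V 1%:M =
    block_mx (1%:M + U *m V) (- U) 0 1%:M *m block_mx 1%:M 0 V 1%:M.
  rewrite mulmx_block !mulmx1 !mul1mx !mul0mx !mulmx0 !add0r mulNmx.
  by rewrite addrK.
have := congr1 determinant eqU.
rewrite eqL !det_mulmx !det_lblock !det_ublock !det1 !mul1r !mulr1.
by move=> <-.
Qed.

Lemma det_mx22 (F : comNzRingType) (M : 'M[F]_2) :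
  \det M = M 0 0 * M 1 1 - M 0 1 * M 1 0.
Proof.
rewrite (expand_det_row _ 0) big_ord_recl big_ord1 /cofactor !det_mx11 !mxE.
rewrite expr0 expr1 mul1r mulN1r mulrN.
(* The indices produced by the cofactor expansion agree with [0] and [1] only as numbers. *)
by congr (M _ _ * M _ _ - M _ _ * M _ _); apply: val_inj.
Qed.

Lemma det_block11 (F : comNzRingType) (a b c d : 'M[F]_1) :
  \det (block_mx a b c d) = a 0 0 * d 0 0 - b 0 0 * c 0 0.
Proof.
rewrite det_mx22 -(block_mxEul a b c d) -(block_mxEur a b c d).
rewrite -(block_mxEdl a b c d) -(block_mxEdr a b c d).
by congr (_ * _ - _ * _); congr fun_of_matrix; apply: val_inj.
Qed.

Section StudyDeterminant.
Variable R : rcfType.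
Local Notation H := (quaternion R).
Local Notation Phi := (@complex_embedding R _ _).

Lemma quat_XD (p q : H) : quat_X (p + q) = quat_X p + quat_X q.
Proof. by case: p q => ? ? ? ? [? ? ? ?]; congr Complex. Qed.

Lemma quat_YD (p q : H) : quat_Y (p + q) = quat_Y p + quat_Y q.
Proof. by case: p q => ? ? ? ? [? ? ? ?]; congr Complex. Qed.

(** This formula and the next come from expanding [(x + y j)(x' + y' j)] with [j z = conjc z j] for
    complex [z] and [j j = -1]. *)
Lemma quat_XM (p q : H) :
  quat_X (p * q) = quat_X p * quat_X q - quat_Y p * conjc (quat_Y q).
Proof. by case: p q => ? ? ? ? [? ? ? ?]; congr Complex => /=; ring. Qed.

Lemma quat_YM (p q : H) :
  quat_Y (p * q) = quat_X p * quat_Y q + quat_Y p * conjc (quat_X q).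
Proof. by case: p q => ? ? ? ? [? ? ? ?]; congr Complex => /=; ring. Qed.

Lemma map_quat_X_mulmx (m n p : nat) (M : 'M[H]_(m, n)) (N : 'M[H]_(n, p)) :
  map_mx (@quat_X R) (M *m N) = map_mx (@quat_X R) M *m map_mx (@quat_X R) N
    - map_mx (@quat_Y R) M *m map_mx conjc (map_mx (@quat_Y R) N).
Proof.
apply/matrixP => i j; rewrite !mxE -sumrB.
rewrite (big_morph (@quat_X R) quat_XD (erefl _)).
by apply: eq_bigr => l _; rewrite !mxE quat_XM.
Qed.

Lemma map_quat_Y_mulmx (m n p : nat) (M : 'M[H]_(m, n)) (N : 'M[H]_(n, p)) :
  map_mx (@quat_Y R) (M *m N) = map_mx (@quat_X R) M *m map_mx (@quat_Y R) N
    + map_mx (@quat_Y R) M *m map_mx conjc (map_mx (@quat_X R) N).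
Proof.
apply/matrixP => i j; rewrite !mxE -big_split /=.
rewrite (big_morph (@quat_Y R) quat_YD (erefl _)).
by apply: eq_bigr => l _; rewrite !mxE quat_YM.
Qed.

(** The upper blocks are the product rules for [quat_X] and [quat_Y]; the lower ones are their
    conjugates up to sign, conjugation being a multiplicative involution. *)
Lemma complex_embeddingM (m n p : nat) (M : 'M[H]_(m, n)) (N : 'M[H]_(n, p)) :
  Phi (M *m N) = Phi M *m Phi N.
Proof.
have conjK (a b : nat) (Z : 'M[R[i]%C]_(a, b)) :
    map_mx conjc (map_mx conjc Z) = Z.
  by apply/matrixP => i j; rewrite !mxE conjcK.
rewrite /complex_embedding mulmx_block map_quat_X_mulmx map_quat_Y_mulmx.
rewrite map_mxB map_mxD !map_mxM !conjK mulmxN !mulNmx mulmxN opprD.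
by congr block_mx; rewrite addrC.
Qed.

Lemma complex_embeddingD (m n : nat) (M N : 'M[H]_(m, n)) :
  Phi (M + N) = Phi M + Phi N.
Proof.
rewrite /complex_embedding add_block_mx.
by congr block_mx; apply/matrixP => i j;
  rewrite !mxE ?quat_XD ?quat_YD ?rmorphD ?opprD.
Qed.

Lemma complex_embedding1 (n : nat) : Phi (1%:M : 'M[H]_n) = 1%:M.
Proof.
rewrite /complex_embedding (scalar_mx_block n n 1).
by congr block_mx; apply/matrixP => i j; rewrite !mxE; case: (i == j);
  apply/eqP; rewrite eq_complex /= ?oppr0 ?eqxx.
Qed.

Lemma SdetM (n : nat) (M N : 'M[H]_n) : Sdet (M *m N) = Sdet M * Sdet N.
Proof.
by rewrite /Sdet complex_embeddingM det_mulmx ComplexField.Normc.normcM.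
Qed.

Lemma Sdet_1DmulmxC (m n : nat) (U : 'M[H]_(m, n)) (V : 'M[H]_(n, m)) :
  Sdet (1%:M + U *m V) = Sdet (1%:M + V *m U).
Proof.
by rewrite /Sdet !complex_embeddingD !complex_embedding1 !complex_embeddingM
  det_1DmulmxC.
Qed.

Lemma Sdet_ge0 (n : nat) (M : 'M[H]_n) : 0 <= Sdet M.
Proof. by rewrite /Sdet; case: (\det _) => a b; apply: sqrtr_ge0. Qed.

(** For [q = x + y j] the embedding has determinant [x conjc x + y conjc y], already a nonnegative
    real. *)
Lemma Sdet_mx11 (M : 'M[H]_1) : Sdet M = quat_abs (M 0 0) ^+ 2.
Proof.
rewrite /Sdet det_block11 !mxE /quat_abs; case: (M 0 0) => a b c d /=.
rewrite sqr_sqrtr ?addr_ge0 ?sqr_ge0 // /ComplexField.Normc.normc /=.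
(* [normc] is a square root, so the right side is written as the root of its own square and the
   radicands are compared. *)
rewrite -[RHS]ger0_norm ?addr_ge0 ?sqr_ge0 // -sqrtr_sqr; congr Num.sqrt; ring.
Qed.

Lemma volM (n : nat) (M N : 'M[H]_n) : vol (M *m N) = vol M * vol N.
Proof. by rewrite /vol SdetM sqrtrM // Sdet_ge0. Qed.

Lemma vol_1Dmulmx (n : nat) (u : 'cV[H]_n) (v : 'rV[H]_n) :
  vol (1%:M + u *m v) = quat_abs (1 + (v *m u) 0 0).
Proof.
rewrite /vol Sdet_1DmulmxC Sdet_mx11 sqrtr_sqr ger0_norm ?sqrtr_ge0 //.
by rewrite !mxE eqxx.
Qed.

Lemma vol1 (n : nat) : vol (1%:M : 'M[H]_n) = 1.
Proof.
by rewrite /vol /Sdet complex_embedding1 det1 ComplexField.Normc.normc1 sqrtr1.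
Qed.

(** By multiplicativity [vol B * vol N = 1], so the nonnegative [vol B] cannot vanish. *)
Lemma vol_gt0 (n : nat) (B N : 'M[H]_n) : B *m N = 1%:M -> 0 < vol B.
Proof.
move=> BN; rewrite lt_def sqrtr_ge0 andbT; apply/eqP => volB0.
have := vol1 n; rewrite -BN volM volB0 mul0r => /esym/eqP.
by rewrite oner_eq0.
Qed.

End StudyDeterminant.

Section SwapVolume.
Variables (R : rcfType) (m n k : nat) (A : 'M[quaternion R]_(m, n)).
Variables (I : 'I_k -> 'I_m) (J : 'I_k -> 'I_n) (N : 'M[quaternion R]_k).
Local Notation B := (mxsub I J A).
Hypothesis BN : is_inverse_mx B N.

Lemma vol_row_swap (q : 'I_k) (p : 'I_m) :
  vol (core_after A I J (RowSwap q p)) =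
    quat_abs ((colsub J A *m N) p q) * vol B.
Proof.
case: BN => _ NB; set C := colsub J A *m N.
(* Since [N *m B = 1], [v *m B] is [A[p, J]] minus row [q] of the core: exactly the correction that
   the swap makes to that row. *)
pose v := row p C - delta_mx 0 q.
have -> : core_after A I J (RowSwap q p) = (1%:M + delta_mx q 0 *m v) *m B.
  rewrite mulmxDl mul1mx -mulmxA mulmxBl -row_mul -mulmxA NB mulmx1 -rowE.
  apply/matrixP => i j; rewrite !mxE big_ord1 !mxE eqxx andbT /=.
  by case: eqP => [->|_]; rewrite ?mul1r ?mul0r ?addr0 // addrC subrK.
(* The [q]-th entry of [v] is [C p q - 1], so the added [1] cancels. [C] is made opaque so that
   [mxE] does not expand the product defining it. *)
by rewrite volM vol_1Dmulmx -colE; clearbody C; rewrite !mxE !eqxx subrKC.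
Qed.

Lemma vol_col_swap (q : 'I_k) (r : 'I_n) :
  vol (core_after A I J (ColSwap q r)) =
    quat_abs ((N *m rowsub I A) q r) * vol B.
Proof.
case: BN => NB _; set C := N *m rowsub I A.
(* Dually, [B *m u] is [A[I, r]] minus column [q] of the core, by [B *m N = 1]. *)
pose u := col r C - delta_mx q 0.
have -> : core_after A I J (ColSwap q r) = B *m (1%:M + u *m delta_mx 0 q).
  rewrite mulmxDr mulmx1 mulmxA mulmxBr colE !mulmxA NB mul1mx -!colE.
  apply/matrixP => i j; rewrite !mxE big_ord1 !mxE eqxx /=.
  by case: eqP => [->|_]; rewrite ?mulr1 ?mulr0 ?addr0 // addrC subrK.
by rewrite volM vol_1Dmulmx -rowE; clearbody C; rewrite !mxE !eqxx subrKC mulrC.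
Qed.

Lemma vol_swap (s : swap m n k) :
  vol (core_after A I J s) = swap_factor A I J N s * vol B.
Proof. by case: s => [q p|q r]; [apply: vol_row_swap | apply: vol_col_swap]. Qed.

End SwapVolume.

Theorem theorem1 (R : realType) (m n k : nat) (A : 'M[quaternion R]_(m, n))
    (accept : ('I_k -> 'I_m) -> ('I_k -> 'I_n) -> swap m n k -> Prop)
    (accept_maxvol : two_sided_maxvol A accept)
    (I : 'I_k -> 'I_m) (J : 'I_k -> 'I_n)
    (I_distinct : injective I) (J_distinct : injective J)
    (Binv : 'M[quaternion R]_k)
    (B_nonsingular : is_inverse_mx (mxsub I J A) Binv) :
  let B := mxsub I J A in
  let C := colsub J A *m Binv in
  let C' := Binv *m rowsub I A in
  (forall s : swap m n k, accept I J s -> vol B < vol (core_after A I J s)) /\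
  (forall s : swap m n k, accept I J s ->
     vol (core_after A I J s) =
       match s with
       | RowSwap q p => quat_abs (C p q) * vol B
       | ColSwap q r => quat_abs (C' q r) * vol B
       end).
Proof.
move=> B C C'; split=> s accs; last first.
  by rewrite (vol_swap _ _ _ _ _ _ _ _ B_nonsingular); case: s {accs}.
have [_ s_gt1] := accept_maxvol I J Binv s I_distinct J_distinct
  B_nonsingular accs.
(* A factor above 1 gives strict growth only because [vol B] is positive, which nonsingularity
   provides. *)
rewrite (vol_swap _ _ _ _ _ _ _ _ B_nonsingular) ltr_pMl //.
by case: B_nonsingular => /vol_gt0.
Qed.
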